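(* Let $q$ be a prime and let $P(y\mid x)$ be a discrete memoryless channel with input alphabet $\mathbb{F}_q$ and finite output alphabet, with capacity $C$, belonging to the class $\mathcal{U}$ of channels whose random-coding error exponent is maximized by the uniform input distribution. Fix a rate $R$ with $0<R<C$. For $N$ and $K<N$ with $K\ln q/N=R$, consider the random linear ensemble: $G$ ($K\times N$) and $\mathbf{v}\in\mathbb{F}_q^N$ with independent uniform entries in $\mathbb{F}_q$, codewords $\mathbf{x}_j=\mathbf{u}_jG+\mathbf{v}$ for $j\in\{0,\dots,q^K-1\}$ with $\mathbf{u}_j$ the $q$-ary representation of $j$, used over the channel $P_N(\mathbf{y}\mid\mathbf{x})=\prod_{n=1}^N P(y_n\mid x_n)$ with maximum-likelihood decoding (ties counted as errors). Let $\overline{P}_{e,m}(N)$ be the ensemble-average probability of decoding error when message $m$ is transmitted. Then $\overline{P}_{e,m}(N)$ does not depend on $m$, and $$-\lim_{N\to\infty}\frac{\ln \overline{P}_{e,m}(N)}{N}=E_r(R),$$ where the limit is along block lengths $N$ for which $K=NR/\ln q$ is an integer.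
   Context: Gallager's random-coding exponent: $E_r(R)=\max_{Q}\max_{0\le\rho\le1}\big[E_0(\rho,Q)-\rho R\big]$ with $E_0(\rho,Q)=-\ln\sum_{y}\big[\sum_{x}Q(x)P(y\mid x)^{1/(1+\rho)}\big]^{1+\rho}$, the maximum over input distributions $Q$ on $\mathbb{F}_q$; for channels in $\mathcal{U}$ this maximum is attained by the uniform distribution $Q(x)=1/q$. Rates are in nats per channel use ($M=q^K=e^{NR}$ codewords). *)

(* Defs.v *)
From HB Require Import structures.
From mathcomp Require Import all_boot all_order all_algebra.
From mathcomp Require Import all_classical all_reals all_analysis.
Set Implicit Arguments. Unset Strict Implicit. Unset Printing Implicit Defensive.
Import Order.TTheory GRing.Theory Num.Theory.
Local Open Scope ring_scope.
Local Open Scope classical_set_scope.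

Section ChannelDefs.
Variables (R : realType) (q : nat) (Y : finType).

Definition is_channel (P : 'F_q -> Y -> R) :=
  (forall x y, 0 <= P x y) /\ (forall x, \sum_(y : Y) P x y = 1).

Definition is_dist (Q : 'F_q -> R) := (forall x, 0 <= Q x) /\ \sum_(x : 'F_q) Q x = 1.

Definition uniform_dist : 'F_q -> R := fun _ => (q%:R)^-1.

(* Output distribution and mutual information (in nats), with 0 ln 0 = 0. *)
Definition out_prob (P : 'F_q -> Y -> R) (Q : 'F_q -> R) (y : Y) : R :=
  \sum_(x : 'F_q) Q x * P x y.

Definition mutual_info (P : 'F_q -> Y -> R) (Q : 'F_q -> R) : R :=
  \sum_(x : 'F_q) \sum_(y : Y)
     (if Q x * P x y == 0 then 0 else Q x * P x y * ln (P x y / out_prob P Q y)).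

Definition capacity (P : 'F_q -> Y -> R) : R := sup [set mutual_info P Q | Q in is_dist].

Definition E0 (P : 'F_q -> Y -> R) (rho : R) (Q : 'F_q -> R) : R :=
  - ln (\sum_(y : Y) (\sum_(x : 'F_q) Q x * P x y `^ (1 + rho)^-1) `^ (1 + rho)).

Definition Er (P : 'F_q -> Y -> R) (Rt : R) : R :=
  sup [set z | exists (rho : R) (Q : 'F_q -> R),
         0 <= rho <= 1 /\ is_dist Q /\ z = E0 P rho Q - rho * Rt].

Definition in_U (P : 'F_q -> Y -> R) : Prop :=
  forall Rt : R, 0 <= Rt <= capacity P ->
    Er P Rt = sup [set z | exists rho : R, 0 <= rho <= 1 /\ z = E0 P rho uniform_dist - rho * Rt].

Definition qary (K : nat) (j : nat) : 'rV['F_q]_K :=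
  \row_(k < K) (((j %/ q ^ k) %% q)%N)%:R.

Definition codeword (K N : nat) (G : 'M['F_q]_(K, N)) (v : 'rV['F_q]_N) (j : nat)
  : 'rV['F_q]_N := qary K j *m G + v.

Definition PN (P : 'F_q -> Y -> R) (N : nat) (x : 'rV['F_q]_N) (y : 'rV[Y]_N) : R :=
  \prod_(n < N) P (x 0 n) (y 0 n).

(* Error probability of ML decoding for message m of the code (G,v),
   ties counted as errors. *)
Definition ml_error (P : 'F_q -> Y -> R) (K N : nat) (G : 'M['F_q]_(K, N))
  (v : 'rV['F_q]_N) (m : 'I_(q ^ K)) : R :=
  \sum_(y : 'rV[Y]_N)
    PN P (codeword G v m) y *
    (if [exists m' : 'I_(q ^ K),
           (m' != m) && (PN P (codeword G v m) y <= PN P (codeword G v m') y)]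
     then 1 else 0).

Definition avg_error (P : 'F_q -> Y -> R) (K N : nat) (m : 'I_(q ^ K)) : R :=
  (#|{: 'M['F_q]_(K, N)}|%:R)^-1 * (#|{: 'rV['F_q]_N}|%:R)^-1 *
  \sum_(G : 'M['F_q]_(K, N)) \sum_(v : 'rV['F_q]_N) ml_error P G v m.

End ChannelDefs.

(* Main.v *)
(** Averaging over [v] and [G] turns the error probability into the mean over a
    uniform word [x] and the sum over [y] of [P(y|x) beta(x, y)], where [beta] is
    the probability that [x + u G] is at least as likely as [x] for some [u <> 0];
    this does not involve the message. Let [p(x, y)] be the probability that a
    uniform word is at least as likely as [x]. The union bound gives
    [beta <= min(1, q^K p) <= (q^K p)^rho], hence Gallager's bound. Conversely the
    messages with first coordinate 1 are pairwise independent, so the second moment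
    method gives [beta >= min(1, q^K p) / (2 q)].

    For the matching lower bound on the sum, change measure to the law of
    [(y, x, x')] under which [x] and [x'] are conditionally i.i.d. given [y] with
    weights proportional to [P(y|x)^(1/(1+rho))]. On the typical set all densities
    are explicit exponentials, and by exchangeability [x'] is at least as likely as
    [x] with conditional probability at least 1/2. The resulting exponent is
    [E0(rho) - rho J(rho) + max(0, J(rho) - R)] with [J] continuous; at [rho = 1],
    at [rho = 0], or at a solution of [J(rho) = R] it equals [E0(rho) - rho R]. *)
Require Import Defs.
From HB Require Import structures.
From mathcomp Require Import all_boot all_order all_algebra.
From mathcomp Require Import all_classical all_reals all_analysis.
From mathcomp Require Import ring lra.
Import Order.TTheory GRing.Theory Num.Theory.
Local Open Scope ring_scope.

(** * Sums over words under product laws, and a weak law of large numbers *)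

Section ProductDistributions.
Set Implicit Arguments.
Unset Strict Implicit.
Variable R : realType.

Lemma sum_row_ffun (A : finType) (N : nat) (F : 'rV[A]_N -> R) :
  \sum_(x : 'rV[A]_N) F x = \sum_(f : {ffun 'I_N -> A}) F (\row_i f i).
Proof.
rewrite (reindex (fun f : {ffun 'I_N -> A} => \row_i f i)) //=.
exists (fun x : 'rV[A]_N => [ffun i => x 0 i]).
  by move=> f _; apply/ffunP=> i; rewrite ffunE mxE.
by move=> x _; apply/rowP=> i; rewrite mxE ffunE.
Qed.

Lemma sum_row_prod (A : finType) (N : nat) (F : 'I_N -> A -> R) :
  \sum_(x : 'rV[A]_N) \prod_(i < N) F i (x 0 i) = \prod_(i < N) \sum_a F i a.
Proof.
rewrite bigA_distr_bigA sum_row_ffun.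
by apply: eq_bigr => f _; apply: eq_bigr => i _; rewrite mxE.
Qed.

Lemma sum_row_pair (A B : finType) (N : nat) (F : 'rV[A]_N -> 'rV[B]_N -> R) :
  \sum_(x : 'rV[A]_N) \sum_(y : 'rV[B]_N) F x y =
  \sum_(t : 'rV[A * B]_N) F (map_mx fst t) (map_mx snd t).
Proof.
rewrite pair_big /=.
rewrite (reindex (fun t : 'rV[A * B]_N => (map_mx fst t, map_mx snd t))) //=.
exists (fun p : 'rV[A]_N * 'rV[B]_N => \row_i (p.1 0 i, p.2 0 i)).
  by move=> t _; apply/rowP=> i; rewrite !mxE; case: (t 0 i).
by move=> [x y] _ /=; congr pair; apply/rowP=> i; rewrite !mxE.
Qed.

(** Independence and centring kill the cross terms; [N] equal diagonal terms remain. *)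
Lemma row_variance (A : finType) (N : nat) (V h : A -> R) :
  \sum_a V a = 1 -> \sum_a V a * h a = 0 ->
  \sum_(t : 'rV[A]_N) (\prod_(i < N) V (t 0 i)) * (\sum_(i < N) h (t 0 i)) ^+ 2 =
  N%:R * \sum_a V a * h a ^+ 2.
Proof.
move=> V1 Vh0.
have cov (i j : 'I_N) : \sum_(t : 'rV[A]_N)
    (\prod_(k < N) V (t 0 k)) * (h (t 0 i) * h (t 0 j)) =
    if i == j then \sum_a V a * h a ^+ 2 else 0.
  (* [G] puts one factor [h] at coordinate [i] and one at [j], so the sum factorises over
     coordinates; the two factors merge into a square when [i = j]. *)
  pose G (k : 'I_N) (a : A) :=
    V a * ((if k == i then h a else 1) * (if k == j then h a else 1)).
  have -> : \sum_(t : 'rV[A]_N)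
      (\prod_(k < N) V (t 0 k)) * (h (t 0 i) * h (t 0 j)) =
      \sum_(t : 'rV[A]_N) \prod_k G k (t 0 k).
    apply: eq_bigr => t _; rewrite big_split big_split /=; congr (_ * (_ * _)).
      rewrite (bigD1 i) //= eqxx big1 ?mulr1 // => k /negbTE -> //.
    rewrite (bigD1 j) //= eqxx big1 ?mulr1 // => k /negbTE -> //.
  rewrite sum_row_prod; case: (eqVneq i j) => [eij|ij].
    rewrite (bigD1 i) //= [X in _ * X]big1 => [|k ki]; last first.
      by rewrite /G -eij (negbTE ki) -[RHS]V1; apply: eq_bigr => a _; rewrite !mulr1.
    by rewrite mulr1; apply: eq_bigr => a _; rewrite /G -eij eqxx -expr2.
  rewrite (bigD1 i) //= (_ : \sum_a G i a = 0) ?mul0r // -[RHS]Vh0.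
  by apply: eq_bigr => a _; rewrite /G eqxx (negbTE ij) mulr1.
transitivity (\sum_(i < N) \sum_(j < N) \sum_(t : 'rV[A]_N)
    (\prod_(k < N) V (t 0 k)) * (h (t 0 i) * h (t 0 j))).
  under [RHS]eq_bigr do rewrite exchange_big /=.
  rewrite [RHS]exchange_big /=.
  apply: eq_bigr => t _; rewrite expr2 mulr_suml mulr_sumr.
  apply: eq_bigr => i _; rewrite mulr_sumr mulr_sumr.
  by apply: eq_bigr => j _; rewrite mulrA.
under eq_bigr => i _.
  under eq_bigr => j _ do rewrite cov.
  rewrite -big_mkcond /= (big_pred1 i) => [|j]; last by rewrite eq_sym.
  over.
by rewrite sumr_const card_ord mulr_natl.
Qed.

(** Markov's inequality for the squared sum. The [1 / N] decay is what later gives the typical words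
    mass at least one half. *)
Lemma row_chebyshev (A : finType) (N : nat) (V h : A -> R) (d : R) :
  (forall a, 0 <= V a) -> \sum_a V a = 1 -> \sum_a V a * h a = 0 -> 0 < d ->
  (0 < N)%N ->
  \sum_(t : 'rV[A]_N | N%:R * d < `|\sum_(i < N) h (t 0 i)|)
     \prod_(i < N) V (t 0 i) <= (\sum_a V a * h a ^+ 2) / d ^+ 2 / N%:R.
Proof.
move=> V0 V1 Vh0 d0 N0.
have Nd : 0 < (N%:R * d) ^+ 2 by rewrite exprn_gt0 // mulr_gt0 ?ltr0n.
have VN0 (t : 'rV[A]_N) : 0 <= \prod_(i < N) V (t 0 i) by apply: prodr_ge0.
have -> : (\sum_a V a * h a ^+ 2) / d ^+ 2 / N%:R =
    (N%:R * \sum_a V a * h a ^+ 2) / (N%:R * d) ^+ 2.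
  by field; rewrite (gt_eqF d0) pnatr_eq0 -lt0n N0.
rewrite ler_pdivlMr // -(row_variance N V1 Vh0) big_mkcond /= mulr_suml.
apply: ler_sum => t _; case: ifP => [big|_]; last by rewrite mul0r mulr_ge0 ?sqr_ge0.
rewrite ler_wpM2l // -[leRHS]real_normK ?num_real //.
apply: lerXn2r; rewrite ?nnegrE ?normr_ge0 ?(ltW big) //.
by rewrite mulr_ge0 ?ler0n ?(ltW d0).
Qed.

End ProductDistributions.

(** * Uniform averages over random linear maps, and the confusion probability *)

Section LinearEnsemble.
Set Implicit Arguments.
Unset Strict Implicit.
Variables (R : realType) (F : finFieldType).

Definition mean (T : finType) (f : T -> R) : R := (#|T|%:R)^-1 * \sum_t f t.

Lemma card_unitr (T : finType) (t : T) : (#|T|%:R : R) != 0.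
Proof. by rewrite pnatr_eq0 -lt0n; apply/card_gt0P; exists t. Qed.

Lemma mean_cst (T : finType) (t : T) (c : R) : mean (fun _ : T => c) = c.
Proof. by rewrite /mean sumr_const -[c *+ _]mulr_natl mulKf ?(card_unitr t). Qed.

Lemma mean_ge0 (T : finType) (f : T -> R) : (forall t, 0 <= f t) -> 0 <= mean f.
Proof. by move=> f0; rewrite mulr_ge0 ?invr_ge0 ?ler0n ?sumr_ge0. Qed.

Lemma ler_mean (T : finType) (f g : T -> R) :
  (forall t, f t <= g t) -> mean f <= mean g.
Proof. by move=> fg; rewrite ler_wpM2l ?invr_ge0 ?ler0n ?ler_sum. Qed.

Lemma mean_sum (T I : finType) (f : I -> T -> R) :
  mean (fun t => \sum_i f i t) = \sum_i mean (f i).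
Proof. by rewrite /mean exchange_big mulr_sumr. Qed.

Lemma meanZ (T : finType) (c : R) (f : T -> R) :
  mean (fun t => c * f t) = c * mean f.
Proof. by rewrite /mean -mulr_sumr mulrCA. Qed.

Lemma eq_mean (T : finType) (f g : T -> R) : f =1 g -> mean f = mean g.
Proof. by move=> fg; rewrite /mean (eq_bigr g). Qed.

Lemma mean_shift (V : finZmodType) (f : V -> R) (c : V) :
  mean (fun v => f (c + v)) = mean f.
Proof.
rewrite /mean; congr (_ * _); rewrite [RHS](reindex (+%R c)) //.
by exists (+%R (- c)) => v _; rewrite ?addKr ?addNKr.
Qed.

Lemma mean_exchange (T U : finType) (f : T -> U -> R) :
  mean (fun t => mean (f t)) = mean (fun u => mean (f ^~ u)).
Proof.
by rewrite /mean -!mulr_sumr mulrCA exchange_big.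
Qed.

(* Translating [G] by [c *m z] does not change its law but moves [u *m G] by an
   arbitrary [z]. *)
Lemma mean_mulmx (K N : nat) (u : 'rV[F]_K) (f : 'rV[F]_N -> R) : u != 0 ->
  mean (fun G : 'M[F]_(K, N) => f (u *m G)) = mean f.
Proof.
move=> u0; have [i ui] : exists i, u 0 i != 0.
  apply/existsP; apply: contraR u0; rewrite negb_exists => /forallP z.
  by apply/eqP/rowP=> i; rewrite mxE; apply/eqP; have := z i; rewrite negbK.
pose c : 'cV[F]_K := (u 0 i)^-1 *: delta_mx i 0.
have uc : u *m c = 1%:M.
  rewrite /c -scalemxAr -colE; apply/matrixP => a b.
  by rewrite !mxE !ord1 mulVf.
(* A mean over a dummy [z] is inserted; once the two means are exchanged, [z] is uniform for each
   fixed [G]. *)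
rewrite -[LHS](mean_cst (0 : 'rV[F]_N)).
transitivity (mean (fun z : 'rV[F]_N => mean (fun G : 'M[F]_(K, N) => f (u *m G + z)))).
  apply: eq_mean => z; rewrite -[LHS](mean_shift _ (c *m z)).
  by apply: eq_mean => G; rewrite mulmxDr mulmxA uc mul1mx addrC.
rewrite mean_exchange -[RHS](mean_cst (0 : 'M[F]_(K, N))).
by apply: eq_mean => G; rewrite mean_shift.
Qed.

(** The columns [c] and [c'] are dual to [u] and [u'], so translating [G] by [c *m z + c' *m z']
    moves the two images independently, by [z] and by [z']. *)
Lemma mean_mulmx2 (K N : nat) (u u' : 'rV[F]_K) (c c' : 'cV[F]_K)
    (f g : 'rV[F]_N -> R) :
  u *m c = 1%:M -> u' *m c = 0 -> u *m c' = 0 -> u' *m c' = 1%:M ->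
  mean (fun G : 'M[F]_(K, N) => f (u *m G) * g (u' *m G)) = mean f * mean g.
Proof.
move=> uc u'c uc' u'c'.
rewrite -[LHS](mean_cst (0 : 'rV[F]_N)).
transitivity (mean (fun z : 'rV[F]_N => mean (fun z' : 'rV[F]_N =>
    mean (fun G : 'M[F]_(K, N) => f (u *m G + z) * g (u' *m G + z'))))).
  apply: eq_mean => z; rewrite -[LHS](mean_cst (0 : 'rV[F]_N)).
  apply: eq_mean => z'; rewrite -[LHS](mean_shift _ (c *m z + c' *m z')).
  apply: eq_mean => G; rewrite !mulmxDr !mulmxA uc u'c uc' u'c' !mul1mx !mul0mx.
  by rewrite addr0 add0r addrC [_ + z']addrC.
under eq_mean => z do rewrite mean_exchange.
rewrite mean_exchange -[RHS](mean_cst (0 : 'M[F]_(K, N))).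
apply: eq_mean => G.
under eq_mean => z do rewrite meanZ mean_shift mulrC.
by rewrite meanZ mean_shift mulrC.
Qed.

(** Distinct nonzero messages may be proportional; with first coordinate 1, distinct ones are
    linearly independent, and their images are then pairwise independent. *)
Definition affine_row (K : nat) (w : 'rV[F]_K) : 'rV[F]_(1 + K) := row_mx 1%:M w.

Lemma affine_row_neq0 (K : nat) (w : 'rV[F]_K) : affine_row w != 0.
Proof.
apply/eqP => /(congr1 lsubmx); rewrite row_mxKl => /matrixP/(_ 0 0).
by rewrite !mxE => /eqP; rewrite oner_eq0.
Qed.

Lemma mean_affine_row2 (K N : nat) (w w' : 'rV[F]_K) (f g : 'rV[F]_N -> R) :
  w != w' ->
  mean (fun G : 'M[F]_(1 + K, N) => f (affine_row w *m G) * g (affine_row w' *m G)) =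
  mean f * mean g.
Proof.
move=> ww'; have [k wk] : exists k, w 0 k != w' 0 k.
  apply/existsP; apply: contraR ww'; rewrite negb_exists => /forallP z.
  by apply/eqP/rowP=> i; apply/eqP; have := z i; rewrite negbK.
have d0 : w' 0 k - w 0 k != 0 by rewrite subr_eq0 eq_sym.
(* Pairing with [vec a b] evaluates an affine function at coordinate [k]. The dual columns are the
   interpolants with values 1, 0 and 0, 1 at [w 0 k], [w' 0 k]. *)
pose vec (a b : F) : 'cV[F]_(1 + K) := col_mx a%:M (b *: delta_mx k 0).
have vecE (v : 'rV[F]_K) a b : affine_row v *m vec a b = (a + b * v 0 k)%:M.
  rewrite mul_row_col mul1mx -scalemxAr -colE; apply/matrixP => i j.
  by rewrite !mxE !ord1 eqxx !mulr1n.
have cst0 : 0 = 0%:M :> 'M[F]_1 by rewrite raddf0.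
apply: (@mean_mulmx2 _ _ _ _ (vec (w' 0 k / (w' 0 k - w 0 k)) (- (w' 0 k - w 0 k)^-1))
  (vec (- w 0 k / (w' 0 k - w 0 k)) (w' 0 k - w 0 k)^-1)); rewrite vecE ?cst0; congr (_%:M);
  by field.
Qed.

(* For [A z := PN P x y <= PN P (x + z) y] this is the probability that maximum
   likelihood decoding of [y] fails when [x] was sent. *)
Definition confusion (K N : nat) (A : pred 'rV[F]_N) : R :=
  mean (fun G : 'M[F]_(K, N) => [exists u, (u != 0) && A (u *m G)]%:R).

Lemma confusion_ge0 (K N : nat) (A : pred 'rV[F]_N) : 0 <= confusion K A.
Proof. by apply: mean_ge0 => G; rewrite ler0n. Qed.

Lemma confusion_le1 (K N : nat) (A : pred 'rV[F]_N) : confusion K A <= 1.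
Proof.
rewrite -[leRHS](mean_cst (0 : 'M[F]_(K, N))); apply: ler_mean => G.
by rewrite lern1 leq_b1.
Qed.

Lemma confusion_union (K N : nat) (A : pred 'rV[F]_N) :
  confusion K A <= #|F|%:R ^+ K * mean (fun z => (A z)%:R).
Proof.
apply: (@le_trans _ _ (mean (fun G : 'M[F]_(K, N) =>
    \sum_(u : 'rV[F]_K) (u != 0)%:R * (A (u *m G))%:R))).
  apply: ler_mean => G; case: existsP => [[u /andP[u0 Au]]|_] /=.
    by rewrite (bigD1 u) //= u0 Au mulr1 lerDl sumr_ge0 // => v _; rewrite mulr_ge0 ?ler0n.
  by rewrite sumr_ge0 // => v _; rewrite mulr_ge0 ?ler0n.
rewrite mean_sum.
have -> : #|F|%:R ^+ K = \sum_(u : 'rV[F]_K) 1 :> R.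
  by rewrite sumr_const card_mx mul1n natrX.
rewrite mulr_suml; apply: ler_sum => u _; rewrite meanZ mul1r.
have p0 : 0 <= mean (fun z : 'rV[F]_N => (A z)%:R).
  by apply: mean_ge0 => z; rewrite ler0n.
case: (eqVneq u 0) => [_|u0] /=; first by rewrite mul0r.
by rewrite mul1r (mean_mulmx (fun z => (A z)%:R) u0).
Qed.

(* Second moment method: [1[S > 0] >= 2 t S - t^2 S^2], optimised at
   [t = 1 / (1 + E S)], for the pairwise independent messages [affine_row w]. *)
Lemma confusion_second_moment (K N : nat) (A : pred 'rV[F]_N) (s : R) :
  s = #|F|%:R ^+ K * mean (fun z => (A z)%:R) ->
  s / (1 + s) <= confusion (1 + K) A.
Proof.
set p := mean _ => sE.
have p0 : 0 <= p by apply: mean_ge0 => z; rewrite ler0n.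
have s0 : 0 <= s by rewrite sE mulr_ge0 ?exprn_ge0 ?ler0n.
pose S (G : 'M[F]_(1 + K, N)) : R := \sum_(w : 'rV[F]_K) (A (affine_row w *m G))%:R.
have card : \sum_(u : 'rV[F]_K) 1 = #|F|%:R ^+ K :> R.
  by rewrite sumr_const card_mx mul1n natrX.
have ES : mean S = s.
  rewrite mean_sum sE -card mulr_suml; apply: eq_bigr => w _.
  by rewrite mul1r (mean_mulmx (fun z => (A z)%:R) (affine_row_neq0 w)).
have ES2 : mean (fun G => S G ^+ 2) <= s + s ^+ 2.
  have -> : mean (fun G => S G ^+ 2) = \sum_(w : 'rV[F]_K) \sum_(w' : 'rV[F]_K)
      mean (fun G : 'M[F]_(1 + K, N) => (A (affine_row w *m G))%:R * (A (affine_row w' *m G))%:R).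
    under [RHS]eq_bigr do rewrite -mean_sum.
    rewrite -mean_sum.
    apply: eq_mean => G; rewrite expr2 /S mulr_suml; apply: eq_bigr => w _.
    by rewrite mulr_sumr.
  rewrite sE -card expr2 -mulrA mulr_suml mulr_suml -big_split /=.
  (* With [p] the mean of [A], the diagonal term gives [p] because an indicator is its own square,
     and each off-diagonal term gives [p ^+ 2]; adding the missing diagonal square only increases
     the bound. *)
  apply: ler_sum => w _; rewrite !mul1r (bigD1 w) //=; apply: lerD.
    rewrite -[leRHS](mean_mulmx (fun z => (A z)%:R) (affine_row_neq0 w)).
    by apply: ler_mean => G; case: (A _); rewrite ?mulr1 ?mulr0.
  rewrite mulr_sumr [leRHS](bigD1 w) //= -[leLHS]add0r.
  apply: lerD; first by rewrite mulr_ge0.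
  apply: ler_sum => w' ww'.
  by rewrite (mean_affine_row2 (fun z => (A z)%:R) (fun z => (A z)%:R)) // eq_sym.
set t := (1 + s)^-1.
have t0 : 0 <= t by rewrite invr_ge0 addr_ge0.
have lowS : mean (fun G => 2 * t * S G - t ^+ 2 * S G ^+ 2) <= confusion (1 + K) A.
  apply: ler_mean => G.
  case: existsP => [_|noA] /=.
    have -> : 2 * t * S G - t ^+ 2 * S G ^+ 2 = 1 - (1 - t * S G) ^+ 2 by ring.
    by rewrite gerBl sqr_ge0.
  suff -> : S G = 0 by rewrite expr0n /= !mulr0 subrr.
  apply: big1 => w _; case E: (A _) => //; case: noA; exists (affine_row w).
  by rewrite affine_row_neq0 E.
apply: le_trans lowS.
have -> : mean (fun G => 2 * t * S G - t ^+ 2 * S G ^+ 2) =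
    2 * t * mean S - t ^+ 2 * mean (fun G => S G ^+ 2).
  by rewrite -!meanZ /mean -mulrBr -sumrB.
rewrite ES; apply: (@le_trans _ _ (2 * t * s - t ^+ 2 * (s + s ^+ 2))).
  rewrite le_eqVlt; apply/orP; left; apply/eqP; rewrite /t; field.
  by rewrite gt_eqF // ltr_pwDl.
by rewrite lerD2l lerN2 ler_wpM2l ?exprn_ge0.
Qed.

(** Keeping only the messages with leading coordinate 1 costs a factor [#|F|]; the factor 2 comes
    from [s / (1 + s) >= min(1, s) / 2]. *)
Lemma confusion_ge_min (K N : nat) (A : pred 'rV[F]_N) :
  (2 * #|F|%:R)^-1 * Num.min 1 (#|F|%:R ^+ K.+1 * mean (fun z => (A z)%:R)) <=
  confusion K.+1 A.
Proof.
apply: le_trans (confusion_second_moment (erefl _)).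
rewrite exprS -mulrA; set s := _ ^+ K * _.
have s0 : 0 <= s.
  by rewrite mulr_ge0 ?exprn_ge0 ?ler0n // mean_ge0 // => z; rewrite ler0n.
have F1 : 1 <= #|F|%:R :> R.
  by rewrite ler1n; apply/card_gt0P; exists 0.
have F0 : 0 < #|F|%:R :> R by apply: lt_le_trans F1.
rewrite ler_pdivlMr ?ltr_pwDl // -mulrA mulrC ler_pdivrMr ?mulr_gt0 //.
have sF : s <= #|F|%:R * s by rewrite ler_peMl.
by have [Fs|Fs] := leP 1 (#|F|%:R * s); nra.
Qed.

End LinearEnsemble.

(** * Reduction of the ensemble average to the confusion probability *)

Section EnsembleAverage.
Set Implicit Arguments.
Unset Strict Implicit.
Variables (R : realType) (q : nat) (Y : finType) (P : 'F_q -> Y -> R).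
Hypothesis q_prime : prime q.

(** By induction, the [k] lowest digits determine [j] modulo [q ^ k]; at [k = K] the residue is [j]
    itself. *)
Lemma qary_inj (K : nat) : injective (fun j : 'I_(q ^ K) => qary q K j).
Proof.
move=> j j' /rowP eq_digits.
have eq_mod k : (k <= K)%N -> (j = j' %[mod q ^ k])%N.
  elim: k => [|k IH] kK; first by rewrite expn0 !modn1.
  have mod_split n : (n %% q ^ k.+1 = n %/ q ^ k %% q * q ^ k + n %% q ^ k)%N.
    have qk : (0 < q ^ k)%N by rewrite expn_gt0 prime_gt0.
    rewrite {1}(divn_eq n (q ^ k)) {1}(divn_eq (n %/ q ^ k) q) mulnDl -mulnA -expnS -addnA modnMDl.
    rewrite modn_small // expnS.
    have := ltn_pmod (n %/ q ^ k) (prime_gt0 q_prime).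
    have := ltn_pmod n qk; move: (n %/ q ^ k %% q)%N (n %% q ^ k)%N => a b lb la.
    by apply: leq_trans (_ : a.+1 * q ^ k <= _)%N; rewrite ?leq_mul2r ?la ?orbT // mulSn addnC ltn_add2r.
  rewrite !mod_split (IH (ltnW kK)); congr (_ * _ + _)%N.
  have := eq_digits (Ordinal kK); rewrite !mxE /= => /(congr1 val) /=.
  by rewrite !val_Fp_nat // !modn_mod.
have := eq_mod K (leqnn K); rewrite !modn_small ?ltn_ord //.
exact: val_inj.
Qed.

Lemma qary_sub_bij (K : nat) (m : 'I_(q ^ K)) :
  bijective (fun j : 'I_(q ^ K) => qary q K j - qary q K m).
Proof.
apply: inj_card_bij; first by move=> i j /addIr /qary_inj.
by rewrite card_mx !card_ord Fp_cast // mul1n.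
Qed.

(** Shifting [v] by [- (qary q K m *m G)] makes the sent word a uniform [x] free of [G]. The
    competitors become [x + u *m G], where by [qary_sub_bij] [u] runs over all nonzero vectors, so
    [m] disappears. *)
Lemma avg_error_confusion (K N : nat) (m : 'I_(q ^ K)) :
  avg_error P N m = mean (fun x : 'rV['F_q]_N => \sum_(y : 'rV[Y]_N)
    PN P x y * confusion R K (fun z => PN P x y <= PN P (x + z) y)).
Proof.
transitivity (mean (fun G : 'M['F_q]_(K, N) => mean (fun v => ml_error P G v m))).
  by rewrite /avg_error /mean -mulrA -mulr_sumr.
transitivity (mean (fun G : 'M['F_q]_(K, N) => mean (fun x : 'rV['F_q]_N =>
   \sum_(y : 'rV[Y]_N) PN P x y *
     [exists u : 'rV['F_q]_K, (u != 0) && (PN P x y <= PN P (x + u *m G) y)]%:R))).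
  apply: eq_mean => G; rewrite -[LHS](mean_shift _ (- (qary q K m *m G))).
  apply: eq_mean => x; apply: eq_bigr => y _.
  have -> : codeword G (- (qary q K m *m G) + x) m = x by rewrite /codeword addNKr.
  congr (_ * _); rewrite -[LHS]/(if _ then _ else _).
  have shift (j : 'I_(q ^ K)) : codeword G (- (qary q K m *m G) + x) j =
      x + (qary q K j - qary q K m) *m G.
    by rewrite /codeword mulmxBl addrA addrC.
  have -> : [exists m', (m' != m) && (PN P x y <=
        PN P (codeword G (- (qary q K m *m G) + x) m') y)] =
      [exists u : 'rV['F_q]_K, (u != 0) && (PN P x y <= PN P (x + u *m G) y)].
    have [g gK Kg] := qary_sub_bij m.
    apply/existsP/existsP => -[].
      move=> j /andP[jm]; rewrite shift => le; exists (qary q K j - qary q K m).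
      by rewrite le andbT subr_eq0; apply: contra jm => /eqP/qary_inj ->.
    move=> u /andP[u0 le]; exists (g u); rewrite shift Kg le andbT.
    by apply: contra u0 => /eqP gm; rewrite -(Kg u) gm subrr.
  by case: [exists _, _].
rewrite mean_exchange; apply: eq_mean => x; rewrite mean_sum.
by apply: eq_bigr => y _; rewrite meanZ.
Qed.

End EnsembleAverage.

(** * Gallager's upper bound on the average error *)

Section GallagerBound.
Set Implicit Arguments.
Unset Strict Implicit.
Variables (R : realType) (q : nat) (Y : finType) (P : 'F_q -> Y -> R).
Hypotheses (q_prime : prime q) (P_channel : is_channel P).

Lemma channel_ge0 x y : 0 <= P x y.
Proof. by case: P_channel. Qed.

Lemma channel_support x : exists y, 0 < P x y.
Proof.
apply/existsP; apply: contraT; rewrite negb_exists => /forallP P0.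
have := proj2 P_channel x; rewrite big1 => [/eqP|y _]; first by rewrite eq_sym oner_eq0.
by apply/eqP; rewrite eq_le channel_ge0 andbT leNgt.
Qed.

Lemma PN_ge0 N (x : 'rV_N) y : 0 <= PN P x y.
Proof. by apply: prodr_ge0 => i _; exact: channel_ge0. Qed.

Lemma natq_gt0 : 0 < (q%:R : R).
Proof. by rewrite ltr0n prime_gt0. Qed.

Lemma mean_row_prod (N : nat) (f : 'I_N -> 'F_q -> R) :
  mean (fun x : 'rV['F_q]_N => \prod_i f i (x 0 i)) = \prod_i \sum_a q%:R^-1 * f i a.
Proof.
rewrite -sum_row_prod /mean card_mx card_Fp // mul1n natrX mulr_sumr.
apply: eq_bigr => x _; rewrite big_split /= prodr_const card_ord exprVn //.
Qed.

Lemma powR_prod (I : finType) (f : I -> R) (r : R) : (forall i, 0 <= f i) ->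
  (\prod_i f i) `^ r = \prod_i f i `^ r.
Proof.
move=> f0.
suff [] : 0 <= \prod_i f i /\ (\prod_i f i) `^ r = \prod_i f i `^ r by [].
apply: (big_ind2 (fun a b => 0 <= a /\ a `^ r = b)) => [|a b c d [a0 <-] [c0 <-]|i _] //.
  by rewrite powR1.
by rewrite mulr_ge0 // powRM.
Qed.

Lemma min1_le_powR (b r : R) : 0 <= b -> 0 <= r <= 1 -> Num.min 1 b <= b `^ r.
Proof.
move=> b0 /andP[r0 r1]; have [b1|b1] := leP 1 b.
  by rewrite -(powRr0 b) ler_powR.
have [->|bn0] := eqVneq b 0; first exact: powR_ge0.
by apply: ger1_powR; rewrite ?r1 // lt_def bn0 b0 ltW.
Qed.

(** With [s = 1 / (1 + rho)], write [PN] as [PN^s * PN^(s rho)]; the second factor is absorbed into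
    the [rho]-th power of the union bound. *)
Lemma gallager_pointwise (K N : nat) (rho : R) (x : 'rV_N) (y : 'rV_N) :
  0 <= rho <= 1 ->
  PN P x y * confusion R K (fun z => PN P x y <= PN P (x + z) y) <=
  (q%:R ^+ K) `^ rho *
  ((mean (fun x' : 'rV_N => PN P x' y `^ (1 + rho)^-1)) `^ rho *
   PN P x y `^ (1 + rho)^-1).
Proof.
move=> rho01; have /andP[rho0 _] := rho01.
set s := (1 + rho)^-1; set a := mean _.
have s0 : 0 < s by rewrite invr_gt0 ltr_pwDl.
have [->|PNn0] := eqVneq (PN P x y) 0.
  by rewrite mul0r mulr_ge0 ?powR_ge0 // mulr_ge0 ?powR_ge0.
have PN0 : 0 < PN P x y by rewrite lt_def PNn0 PN_ge0.
set p := mean (fun z : 'rV_N => (PN P x y <= PN P (x + z) y)%R%:R : R).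
have p0 : 0 <= p by apply: mean_ge0 => z; rewrite ler0n.
have qK0 : 0 <= (q%:R : R) ^+ K by rewrite exprn_ge0 ?ler0n.
have conf : confusion R K (fun z => PN P x y <= PN P (x + z) y) <=
    (q%:R ^+ K * p) `^ rho.
  apply: le_trans (min1_le_powR _ rho01); last by rewrite mulr_ge0.
  rewrite le_min confusion_le1 /=.
  by have := @confusion_union R 'F_q K N (fun z => PN P x y <= PN P (x + z) y); rewrite card_Fp.
(* Markov's inequality at power [s]: every word counted by [p] is at least as likely as [x]. *)
have pa : PN P x y `^ s * p <= a.
  rewrite /p (mean_shift (fun x' => (PN P x y <= PN P x' y)%R%:R)) -meanZ.
  apply: ler_mean => x'; have [le|_] := leP (PN P x y) (PN P x' y); last by rewrite mulr0 powR_ge0.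
  by rewrite mulr1; apply: ge0_ler_powR; rewrite ?nnegrE ?PN_ge0 // ltW.
have split1 : PN P x y = PN P x y `^ s * PN P x y `^ (s * rho).
  rewrite -powRD; last by rewrite PNn0 implybT.
  by rewrite (_ : s + s * rho = 1) ?powRr1 ?PN_ge0 // /s; field; rewrite gt_eqF // ltr_pwDl.
apply: le_trans (ler_wpM2l (ltW PN0) conf) _.
rewrite powRM // mulrCA ler_wpM2l ?powR_ge0 //.
rewrite [X in X * _]split1 -mulrA mulrC ler_wpM2r ?powR_ge0 //.
rewrite powRrM -powRM ?powR_ge0 //.
have Pp0 : 0 <= PN P x y `^ s * p by rewrite mulr_ge0 ?powR_ge0.
by apply: ge0_ler_powR; rewrite ?nnegrE // (le_trans Pp0).
Qed.

Lemma avg_error_upper (K N : nat) (m : 'I_(q ^ K)) (rho Rt : R) :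
  0 <= rho <= 1 -> K%:R * ln (q%:R : R) = N%:R * Rt ->
  avg_error P N m <= expR (- (N%:R * (E0 P rho (uniform_dist R (q:=q)) - rho * Rt))).
Proof.
move=> rho01 rate; have /andP[rho0 _] := rho01.
set s := (1 + rho)^-1.
pose alpha y := \sum_x uniform_dist R (q:=q) x * P x y `^ s.
have alpha0 y : 0 <= alpha y.
  by apply: sumr_ge0 => x _; rewrite mulr_ge0 ?powR_ge0 // invr_ge0 ler0n.
have meanE (y : 'rV[Y]_N) : mean (fun x : 'rV_N => PN P x y `^ s) = \prod_i alpha (y 0 i).
  rewrite -mean_row_prod; apply: eq_mean => x.
  by rewrite powR_prod // => i; exact: channel_ge0.
rewrite avg_error_confusion //.
apply: (@le_trans _ _ ((q%:R ^+ K) `^ rho * (\sum_y alpha y `^ (1 + rho)) ^+ N)).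
  apply: le_trans (ler_mean (fun x => ler_sum _ (fun y _ =>
    gallager_pointwise K x y rho01))) _.
  under eq_mean do rewrite -mulr_sumr.
  rewrite meanZ mean_sum ler_wpM2l ?powR_ge0 //.
  have -> : (\sum_y alpha y `^ (1 + rho)) ^+ N =
      \sum_(y : 'rV[Y]_N) \prod_i alpha (y 0 i) `^ (1 + rho).
    by rewrite (sum_row_prod (fun _ b => alpha b `^ (1 + rho))) prodr_const card_ord.
  (* The mean over [x] supplies one more factor [alpha], raising the exponent from [rho] to
     [1 + rho]. *)
  apply: ler_sum => y _; rewrite meanZ meanE -powR_prod // addrC powRD ?powRr1 ?prodr_ge0 //.
  by rewrite gt_eqF // ltr_wpDl.
have Z0 : 0 < \sum_y alpha y `^ (1 + rho).
  have [y Py] := channel_support 0.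
  have a0 : 0 < alpha y.
    rewrite /alpha (bigD1 0) //= ltr_pwDl ?mulr_gt0 ?powR_gt0 ?invr_gt0 ?natq_gt0 //.
    by apply: sumr_ge0 => x _; rewrite mulr_ge0 ?powR_ge0 // invr_ge0 ler0n.
  rewrite (bigD1 y) //= ltr_pwDl ?powR_gt0 //.
  by apply: sumr_ge0 => z _; rewrite powR_ge0.
rewrite /E0 -/s -[X in - ln X]/(\sum_y alpha y `^ (1 + rho)).
rewrite (_ : - _ = rho * (N%:R * Rt) + N%:R * ln (\sum_y alpha y `^ (1 + rho))); last by ring.
rewrite expRD expRM_natl lnK ?posrE // -rate /powR expf_eq0 (gt_eqF natq_gt0) andbF.
by rewrite lnXn ?natq_gt0 // mulr_natl.
Qed.
End GallagerBound.

(** * The tilted law and its densities *)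

Section TiltedChannel.
Set Implicit Arguments.
Unset Strict Implicit.
Variables (R : realType) (q : nat) (Y : finType) (P : 'F_q -> Y -> R).
Hypotheses (q_prime : prime q) (P_channel : is_channel P).

(* Unlike [powR], this vanishes at [p = 0] for every exponent [r]. *)
Definition spow (p r : R) : R := if p == 0 then 0 else expR (r * ln p).

Lemma spow0 r : spow 0 r = 0.
Proof. by rewrite /spow eqxx. Qed.

Lemma spowE p r : 0 < p -> spow p r = expR (r * ln p).
Proof. by rewrite /spow => /gt_eqF ->. Qed.

Lemma spow_ge0 p r : 0 <= spow p r.
Proof. by rewrite /spow; case: ifP => // _; exact: expR_ge0. Qed.

Lemma spow_gt0 p r : 0 < p -> 0 < spow p r.
Proof. by move=> p0; rewrite spowE ?expR_gt0. Qed.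

Lemma spow_powR p r : r != 0 -> spow p r = p `^ r.
Proof. by move=> /negbTE r0; rewrite /spow /powR r0. Qed.

Definition letter_weight (rho : R) (x : 'F_q) (y : Y) : R :=
  q%:R^-1 * spow (P x y) (1 + rho)^-1.

Definition output_weight (rho : R) (y : Y) : R := \sum_x letter_weight rho x y.

(** The normaliser of [tilt]; for [rho >= 0] it is [exp(- E0)] at the uniform input. *)
Definition partition_sum (rho : R) : R :=
  \sum_y spow (output_weight rho y) (1 + rho).

(* The law of [(y, x, x')] in which [x] and [x'] are conditionally independent
   given [y], each pair [(x, y)] and [(x', y)] following the tilted law. *)
Definition tilt (rho : R) (t : Y * ('F_q * 'F_q)) : R :=
  letter_weight rho t.2.1 t.1 * letter_weight rho t.2.2 t.1 *
  spow (output_weight rho t.1) (rho - 1) / partition_sum rho.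

Definition joint_weight rho x y :=
  letter_weight rho x y * spow (output_weight rho y) rho / partition_sum rho.

Definition cond_weight rho x y := letter_weight rho x y / output_weight rho y.

Definition tilt_lnP rho : R := \sum_t tilt rho t * ln (P t.2.1 t.1).

Definition tilt_lnW rho : R := \sum_t tilt rho t * ln (output_weight rho t.1).

(** The [J(rho)] of the lower bound: the mean log-ratio of [cond_weight] to the uniform probability
    [1 / q], that is, a conditional divergence. *)
Definition tilt_info rho : R :=
  \sum_t tilt rho t * ((1 + rho)^-1 * ln (P t.2.1 t.1) - ln (output_weight rho t.1)).

Lemma tilt_infoE rho : tilt_info rho = (1 + rho)^-1 * tilt_lnP rho - tilt_lnW rho.
Proof.
rewrite /tilt_lnP /tilt_lnW mulr_sumr -sumrB; apply: eq_bigr => t _.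
by rewrite mulrBr mulrCA.
Qed.

Lemma letter_weight_ge0 rho x y : 0 <= letter_weight rho x y.
Proof. by rewrite mulr_ge0 ?spow_ge0 // invr_ge0 ler0n. Qed.

Lemma output_weight_ge0 rho y : 0 <= output_weight rho y.
Proof. by apply: sumr_ge0 => x _; exact: letter_weight_ge0. Qed.

Lemma letter_weight_gt0 rho x y : 0 < P x y -> 0 < letter_weight rho x y.
Proof. by move=> Pxy; rewrite mulr_gt0 ?spow_gt0 // invr_gt0 natq_gt0. Qed.

Lemma output_weight_gt0 rho x y : 0 < P x y -> 0 < output_weight rho y.
Proof.
move=> Pxy; rewrite /output_weight (bigD1 x) //= ltr_pwDl ?letter_weight_gt0 //.
by apply: sumr_ge0 => x' _; exact: letter_weight_ge0.
Qed.

Lemma partition_sum_gt0 rho : 0 < partition_sum rho.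
Proof.
have [y Py] := channel_support P_channel 0.
rewrite /partition_sum (bigD1 y) //= ltr_pwDl ?spow_gt0 ?(output_weight_gt0 _ Py) //.
by apply: sumr_ge0 => z _; exact: spow_ge0.
Qed.

Lemma tilt_ge0 rho t : 0 <= tilt rho t.
Proof.
by rewrite mulr_ge0 ?invr_ge0 ?(ltW (partition_sum_gt0 _)) // !mulr_ge0
  ?letter_weight_ge0 ?spow_ge0.
Qed.

Lemma sum_tiltE rho (f : Y -> 'F_q -> 'F_q -> R) :
  \sum_t tilt rho t * f t.1 t.2.1 t.2.2 =
  \sum_y \sum_x \sum_x' tilt rho (y, (x, x')) * f y x x'.
Proof.
under [RHS]eq_bigr => y _ do rewrite pair_big /=.
rewrite pair_big /=; apply: eq_bigr => -[y [x x']] _ //.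
Qed.

(** For each [y], summing out [x] and [x'] leaves [W^2 * W^(rho - 1) = W^(1 + rho)], the summand of
    [partition_sum]; outputs of weight 0 vanish on both sides. *)
Lemma sum_tilt rho : \sum_t tilt rho t = 1.
Proof.
have Z0 := partition_sum_gt0 rho.
under eq_bigr do rewrite -[tilt _ _]mulr1.
rewrite (sum_tiltE rho (fun _ _ _ => 1)).
rewrite -[RHS](divff (lt0r_neq0 Z0)) {1}/partition_sum mulr_suml; apply: eq_bigr => y _.
under eq_bigr => x _.
  under eq_bigr => x' _ do rewrite mulr1 /tilt /= -2!mulrA.
  rewrite -mulr_sumr -mulr_suml; over.
rewrite -mulr_suml -/(output_weight rho y).
have [->|w0] := eqVneq (output_weight rho y) 0; first by rewrite !spow0 !(mulr0, mul0r).
have {}w0 : 0 < output_weight rho y by rewrite lt_def w0 output_weight_ge0.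
rewrite !mulrA; congr (_ / _); rewrite -[X in X * X * _]lnK ?posrE // -!expRD !spowE //.
by rewrite -!expRD; congr expR; ring.
Qed.

Lemma tilt_swap rho y x x' : tilt rho (y, (x, x')) = tilt rho (y, (x', x)).
Proof. by rewrite /tilt /= [letter_weight _ x _ * _]mulrC. Qed.

Lemma tilt_lnP_swap rho : \sum_t tilt rho t * ln (P t.2.2 t.1) = tilt_lnP rho.
Proof.
rewrite /tilt_lnP (sum_tiltE rho (fun y x x' => ln (P x' y))).
rewrite (sum_tiltE rho (fun y x x' => ln (P x y))); apply: eq_bigr => y _.
by rewrite exchange_big /=; apply: eq_bigr => x _; apply: eq_bigr => x' _; rewrite tilt_swap.
Qed.

Lemma tilt_split rho y x x' :
  tilt rho (y, (x, x')) = joint_weight rho x y * cond_weight rho x' y.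
Proof.
rewrite /tilt /joint_weight /cond_weight /=.
have [->|w0] := eqVneq (output_weight rho y) 0; first by rewrite !spow0 !(mulr0, mul0r).
have {}w0 : 0 < output_weight rho y by rewrite lt_def w0 output_weight_ge0.
rewrite !spowE // mulrBl mul1r expRD expRN lnK ?posrE //.
by field; rewrite !gt_eqF ?partition_sum_gt0.
Qed.

(** The density of the true law of [(x, y)] against the tilted one. Its exponent is [rho] times the
    summand of [tilt_info], hence concentrates on typical pairs. *)
Lemma channel_tilt rho x y : 0 <= rho -> 0 < P x y ->
  q%:R^-1 * P x y = joint_weight rho x y * partition_sum rho *
    expR (rho * ((1 + rho)^-1 * ln (P x y) - ln (output_weight rho y))).
Proof.
move=> rho0 Pxy; have w0 := output_weight_gt0 rho Pxy.
rewrite /joint_weight divfK ?gt_eqF ?partition_sum_gt0 // /letter_weight.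
rewrite !spowE // -!mulrA -!expRD; congr (_ * _).
rewrite -[LHS]lnK ?posrE //; congr expR; field.
by rewrite gt_eqF // ltr_pwDl.
Qed.

Lemma uniform_tilt rho x y : 0 < P x y ->
  q%:R^-1 = cond_weight rho x y *
    expR (ln (output_weight rho y) - (1 + rho)^-1 * ln (P x y)).
Proof.
move=> Pxy; have w0 := output_weight_gt0 rho Pxy.
rewrite /cond_weight /letter_weight spowE // expRD expRN lnK ?posrE //.
by field; rewrite !gt_eqF ?expR_gt0 ?natq_gt0.
Qed.

Lemma E0_partition_sum rho : 0 <= rho ->
  E0 P rho (uniform_dist R (q:=q)) = - ln (partition_sum rho).
Proof.
move=> rho0; have r0 : 1 + rho != 0 by rewrite gt_eqF // ltr_pwDl.
rewrite /E0 /partition_sum; congr (- ln _); apply: eq_bigr => y _.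
rewrite spow_powR //; congr (_ `^ _); apply: eq_bigr => x _.
by rewrite /letter_weight spow_powR ?invr_eq0.
Qed.

End TiltedChannel.

(** * Typical words under the tilted law *)

Section LowerBound.
Set Implicit Arguments.
Unset Strict Implicit.
Variables (R : realType) (q : nat) (Y : finType) (P : 'F_q -> Y -> R).
Hypotheses (q_prime : prime q) (P_channel : is_channel P).
Variable rho : R.
Hypothesis rho01 : 0 <= rho <= 1.

Let lnP := tilt_lnP P rho.
Let lnW := tilt_lnW P rho.
Let W := output_weight P rho.
Let J := tilt_info P rho.

(** These two empirical means control both densities, [channel_tilt] and [uniform_tilt]. *)
Definition typical (d : R) (N : nat) (x : 'rV['F_q]_N) (y : 'rV[Y]_N) : bool :=
  (`|\sum_i (ln (P (x 0 i) (y 0 i)) - lnP)| <= N%:R * d) &&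
  (`|\sum_i (ln (W (y 0 i)) - lnW)| <= N%:R * d).

Lemma sum_subc (N : nat) (f : 'I_N -> R) (c : R) :
  \sum_i f i = \sum_i (f i - c) + N%:R * c.
Proof. by rewrite sumrB sumr_const card_ord mulr_natl subrK. Qed.

(** Taken at [c = rho] for the channel density and at [c = 1] for the uniform one. Two sums with
    coefficients at most 1 deviate by [N * d] each, whence [2 * d]. *)
Lemma typical_sums (d : R) (N : nat) (x : 'rV_N) (y : 'rV_N) (c : R) :
  typical d x y -> 0 <= c <= 1 ->
  `|\sum_i (c * ((1 + rho)^-1 * ln (P (x 0 i) (y 0 i)) - ln (W (y 0 i)))) -
    N%:R * (c * J)| <= N%:R * (2 * d).
Proof.
have /andP[rho0 rho1] := rho01.
move=> /andP[tP tW] /andP[c0 c1].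
set s := (1 + rho)^-1.
have s0 : 0 <= s by rewrite invr_ge0 addr_ge0.
have s1 : s <= 1 by rewrite invf_le1 ?ltr_pwDl // lerDl.
rewrite -mulr_sumr sumrB -mulr_sumr (sum_subc (fun i => ln (P (x 0 i) (y 0 i))) lnP).
rewrite (sum_subc (fun i => ln (W (y 0 i))) lnW).
move: tP tW; set SP := \sum_i _; set SW := \sum_i _ => tP tW.
rewrite /J tilt_infoE -/lnP -/lnW -/s.
have -> : c * (s * (SP + N%:R * lnP) - (SW + N%:R * lnW)) -
    N%:R * (c * (s * lnP - lnW)) = c * (s * SP - SW) by ring.
rewrite normrM (ger0_norm c0).
apply: (@le_trans _ _ `|s * SP - SW|); first by rewrite ler_piMl.
apply: le_trans (ler_normB _ _) _; rewrite normrM (ger0_norm s0).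
rewrite (_ : N%:R * (2 * d) = N%:R * d + N%:R * d); last by ring.
apply: lerD => //; apply: le_trans tP.
by rewrite ler_piMl.
Qed.

Lemma joint_weight_ge0 x y : 0 <= joint_weight P rho x y.
Proof.
by rewrite mulr_ge0 ?invr_ge0 ?(ltW (partition_sum_gt0 _ _ _)) // mulr_ge0
  ?letter_weight_ge0 ?spow_ge0.
Qed.

Lemma cond_weight_ge0 x y : 0 <= cond_weight P rho x y.
Proof. by rewrite mulr_ge0 ?letter_weight_ge0 // invr_ge0 output_weight_ge0. Qed.

Lemma letter_weight0 x y : P x y = 0 -> letter_weight P rho x y = 0.
Proof. by move=> E; rewrite /letter_weight E spow0 mulr0. Qed.

Lemma full_support (N : nat) (x : 'rV_N) (y : 'rV_N) :
  (forall i, 0 < P (x 0 i) (y 0 i)) \/ (exists i, P (x 0 i) (y 0 i) = 0).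
Proof.
case: (pickP (fun i => P (x 0 i) (y 0 i) == 0)) => [i /eqP ?|no]; [by right; exists i|left].
by move=> i; rewrite lt_def channel_ge0 // andbT (no i).
Qed.

Lemma channel_typical (d : R) (N : nat) (x : 'rV_N) (y : 'rV_N) :
  typical d x y ->
  (\prod_i joint_weight P rho (x 0 i) (y 0 i)) *
    (partition_sum P rho ^+ N * expR (N%:R * (rho * J - 2 * d))) <=
  q%:R^-1 ^+ N * PN P x y.
Proof.
have /andP[rho0 rho1] := rho01.
(* Since [ln 0 = 0], [typical] does not exclude pairs of probability 0; there the tilted weight
   vanishes and the bound is trivial. *)
move=> typ; have [Ppos|[i Pi0]] := full_support x y; last first.
  rewrite (bigD1 i) //= /joint_weight (letter_weight0 Pi0) !mul0r.
  by rewrite mulr_ge0 ?PN_ge0 // exprn_ge0 // invr_ge0 ler0n.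
have -> : q%:R^-1 ^+ N * PN P x y =
    \prod_i (q%:R^-1 * P (x 0 i) (y 0 i)).
  by rewrite big_split /= prodr_const card_ord.
rewrite (eq_bigr _ (fun i _ => channel_tilt q_prime P_channel rho0 (Ppos i))).
rewrite [leRHS]big_split /= [X in _ <= X * _]big_split /= prodr_const card_ord -[leRHS]mulrA.
apply: ler_wpM2l; first by apply: prodr_ge0 => i _; exact: joint_weight_ge0.
rewrite ler_wpM2l ?exprn_ge0 ?(ltW (partition_sum_gt0 _ _ _)) //.
rewrite -expR_sum ler_expR.
have := typical_sums typ rho01; rewrite ler_norml => /andP[+ _].
by rewrite mulrBr; lra.
Qed.

Lemma uniform_typical (d : R) (N : nat) (x : 'rV_N) (y : 'rV_N) :
  typical d x y ->
  (\prod_i cond_weight P rho (x 0 i) (y 0 i)) * expR (N%:R * (- J - 2 * d)) <=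
  q%:R^-1 ^+ N.
Proof.
move=> typ; have [Ppos|[i Pi0]] := full_support x y; last first.
  rewrite (bigD1 i) //= /cond_weight (letter_weight0 Pi0) !mul0r.
  by rewrite exprn_ge0 // invr_ge0 ler0n.
have -> : (q%:R^-1 : R) ^+ N = \prod_(i < N) q%:R^-1.
  by rewrite prodr_const card_ord.
rewrite [leRHS](eq_bigr _ (fun i _ => uniform_tilt q_prime rho (Ppos i))).
rewrite [leRHS]big_split /=; apply: ler_wpM2l; first by apply: prodr_ge0 => i _; exact: cond_weight_ge0.
rewrite -expR_sum ler_expR.
have c01 : 0 <= (1 : R) <= 1 by rewrite ler01 lexx.
have := typical_sums typ c01; rewrite ler_norml => /andP[_ +].
under eq_bigr do rewrite mul1r -opprB.
by rewrite sumrN -/W mul1r mulrBr mulrN; lra.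
Qed.

Definition tiltN (N : nat) (y : 'rV[Y]_N) (x x' : 'rV['F_q]_N) : R :=
  \prod_i tilt P rho (y 0 i, (x 0 i, x' 0 i)).

Lemma tiltN_swap N (y : 'rV_N) (x x' : 'rV_N) : tiltN y x x' = tiltN y x' x.
Proof. by apply: eq_bigr => i _; exact: tilt_swap. Qed.

Lemma tiltN_ge0 N (y : 'rV_N) (x x' : 'rV_N) : 0 <= tiltN y x x'.
Proof. by apply: prodr_ge0 => i _; exact: tilt_ge0. Qed.

Let devP (t : Y * ('F_q * 'F_q)) := ln (P t.2.1 t.1) - lnP.
Let devP' (t : Y * ('F_q * 'F_q)) := ln (P t.2.2 t.1) - lnP.
Let devW (t : Y * ('F_q * 'F_q)) := ln (W t.1) - lnW.

Definition tilt_var : R :=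
  \sum_t tilt P rho t * devP t ^+ 2 + \sum_t tilt P rho t * devP' t ^+ 2 +
  \sum_t tilt P rho t * devW t ^+ 2.

(** A union bound over three Chebyshev estimates, for [ln P] at [x], [ln P] at [x'] and [ln W]; by
    [tilt_lnP_swap] the first two share their centre. *)
Lemma tilt_typical (d : R) (N : nat) : 0 < d -> (0 < N)%N ->
  1 - tilt_var / d ^+ 2 / N%:R <=
  \sum_(y : 'rV[Y]_N) \sum_x \sum_x' tiltN y x x' * (typical d x y && typical d x' y)%:R.
Proof.
move=> d0 N0.
have tilt0 := tilt_ge0 q_prime P_channel rho.
have tilt1 := sum_tilt q_prime P_channel rho.
under [leRHS]eq_bigr do rewrite sum_row_pair.
rewrite sum_row_pair.
have center (f : Y * ('F_q * 'F_q) -> R) c : \sum_t tilt P rho t * f t = c ->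
    \sum_t tilt P rho t * (f t - c) = 0.
  by move=> <-; under eq_bigr do rewrite mulrBr; rewrite sumrB -mulr_suml tilt1 mul1r subrr.
have cP := row_chebyshev tilt0 tilt1 (center _ _ (erefl _ : _ = lnP)) d0 N0.
have cP' := row_chebyshev tilt0 tilt1 (center _ _ (tilt_lnP_swap P rho : _ = lnP)) d0 N0.
have cW := row_chebyshev tilt0 tilt1 (center _ _ (erefl _ : _ = lnW)) d0 N0.
have {cP cP' cW} := lerD (lerD cP cP') cW.
rewrite -!mulrDl -/tilt_var => bad.
have total : \sum_(t : 'rV_N) \prod_i tilt P rho (t 0 i) = 1.
  by rewrite (sum_row_prod (fun _ => tilt P rho)) big1.
rewrite lerBlDl -[leLHS]total; set S := (X in _ <= _ + X).
apply: (@le_trans _ _ _ _ _ _ (lerD bad (lexx S))); rewrite {}/S.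
rewrite (big_mkcond (fun t : 'rV_N => _ < `|\sum_i (ln (P (t 0 i).2.1 _) - _)|)) /=.
rewrite (big_mkcond (fun t : 'rV_N => _ < `|\sum_i (ln (P (t 0 i).2.2 _) - _)|)) /=.
rewrite (big_mkcond (fun t : 'rV_N => _ < `|\sum_i (ln (output_weight _ _ _) - _)|)) /=.
rewrite -!big_split /=; apply: ler_sum => t _.
have -> : tiltN (map_mx fst t) (map_mx fst (map_mx snd t)) (map_mx snd (map_mx snd t)) =
    \prod_i tilt P rho (t 0 i).
  by apply: eq_bigr => i _; rewrite !mxE; case: (t 0 i) => [? []].
have V0 : 0 <= \prod_i tilt P rho (t 0 i) by apply: prodr_ge0.
rewrite /typical.
have -> : \sum_i (ln (P ((map_mx fst (map_mx snd t)) 0 i) ((map_mx fst t) 0 i)) - lnP) =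
    \sum_i (ln (P (t 0 i).2.1 (t 0 i).1) - lnP).
  by apply: eq_bigr => i _; rewrite !mxE.
have -> : \sum_i (ln (P ((map_mx snd (map_mx snd t)) 0 i) ((map_mx fst t) 0 i)) - lnP) =
    \sum_i (ln (P (t 0 i).2.2 (t 0 i).1) - lnP).
  by apply: eq_bigr => i _; rewrite !mxE.
have -> : \sum_i (ln (W ((map_mx fst t) 0 i)) - lnW) =
    \sum_i (ln (W (t 0 i).1) - lnW).
  by apply: eq_bigr => i _; rewrite !mxE.
by do 3 case: ltP => _; rewrite /= ?mulr1 ?mulr0 ?addr0 ?add0r ?lexx ?addr_ge0 // ?lerDl ?lerDr ?addr_ge0.
Qed.

(** Exchanging [x] and [x'] preserves [tiltN] and reverses the comparison. One of the two
    comparisons always holds, so the right side and its mirror image together cover the typical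
    mass. *)
Lemma tilt_pairwise (d : R) (N : nat) :
  2^-1 * (\sum_(y : 'rV[Y]_N) \sum_x \sum_x'
     tiltN y x x' * (typical d x y && typical d x' y)%:R) <=
  \sum_(y : 'rV[Y]_N) \sum_x \sum_x'
     tiltN y x x' * [&& typical d x y, typical d x' y & PN P x y <= PN P x' y]%:R.
Proof.
rewrite mulr_sumr; apply: ler_sum => y _.
set D := (X in _ <= X).
have D' : D = \sum_x \sum_x'
     tiltN y x x' * [&& typical d x y, typical d x' y & PN P x' y <= PN P x y]%:R.
  rewrite /D exchange_big /=; apply: eq_bigr => x _; apply: eq_bigr => x' _.
  by rewrite tiltN_swap andbCA.
rewrite mulrC ler_pdivrMr // mulrDr mulr1 {2}D' /D -big_split /=.
apply: ler_sum => x _; rewrite -big_split /=; apply: ler_sum => x' _.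
rewrite -mulrDr ler_wpM2l ?tiltN_ge0 //.
case: typical; case: typical; rewrite /= ?addr0 //.
by case/orP: (le_total (PN P x y) (PN P x' y)) => ->; rewrite ?lerDl ?lerDr ?ler0n.
Qed.

End LowerBound.

(** * Continuity of [tilt_info] and choice of the tilt *)

Section CriticalTilt.
Set Implicit Arguments.
Unset Strict Implicit.
Import numFieldNormedType.Exports.
Variables (R : realType) (q : nat) (Y : finType) (P : 'F_q -> Y -> R).
Hypotheses (q_prime : prime q) (P_channel : is_channel P).

Lemma continuous_at_sum (I : finType) (f : I -> R -> R) (r : R) :
  (forall i, {for r, continuous (f i)}) ->
  {for r, continuous (fun r => \sum_i f i r)}.
Proof.
move=> fc; apply: cvg_big => // [|i _]; last exact: fc.
exact: (@pseudometric_normed_Zmodule.add_continuous R R).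
Qed.

Lemma continuous_at_expR (f : R -> R) (r : R) :
  {for r, continuous f} -> {for r, continuous (fun r => expR (f r))}.
Proof. by move=> fc; apply: (@continuous_comp _ _ _ f expR) => //; exact: continuous_expR. Qed.

(** [spow] can jump at base 0, so the base must vanish identically or stay positive. *)
Lemma continuous_at_spow (f g : R -> R) (r : R) :
  (forall r, f r = 0) \/ (forall r, 0 < f r) ->
  {for r, continuous f} -> {for r, continuous g} ->
  {for r, continuous (fun r => spow (f r) (g r))}.
Proof.
move=> [f0|f0] fc gc.
  rewrite (_ : (fun _ => _) = fun _ : R => 0); first exact: cvg_cst.
  by apply/funext => t; rewrite f0 spow0.
rewrite (_ : (fun _ => _) = fun t => expR (g t * ln (f t))); last first.
  by apply/funext => t; rewrite spowE.
apply: continuous_at_expR; apply: continuousM => //.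
by apply: (@continuous_comp _ _ _ f (@ln R)) => //; exact: continuous_ln.
Qed.

Lemma continuous_letter_weight x y (r : R) : 0 <= r ->
  {for r, continuous (fun r => letter_weight P r x y)}.
Proof.
move=> r0; apply: continuousM; first exact: cvg_cst.
apply: continuous_at_spow; [|exact: cvg_cst|].
  have := channel_ge0 P_channel x y; rewrite le_eqVlt => /orP[/eqP <-|]; by [left|right].
apply: continuousV; first by rewrite gt_eqF // ltr_pwDl.
by apply: continuousD; [exact: cvg_cst|exact: cvg_id].
Qed.

Lemma continuous_output_weight y (r : R) : 0 <= r ->
  {for r, continuous (fun r => output_weight P r y)}.
Proof. by move=> r0; apply: continuous_at_sum => x; exact: continuous_letter_weight. Qed.

(** Positivity depends on whether some input can produce [y], never on [rho]. *)
Lemma output_weight_dichotomy y :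
  (forall r, output_weight P r y = 0) \/ (forall r, 0 < output_weight P r y).
Proof.
case: (pickP (fun x => P x y != 0)) => [x Px|P0].
  have Pxy : 0 < P x y by rewrite lt_def Px channel_ge0.
  by right=> r; exact: (output_weight_gt0 q_prime r Pxy).
left=> r; apply: big1 => x _; apply: letter_weight0.
by apply/eqP; have /negbFE := P0 x.
Qed.

Lemma continuous_tilt t (r : R) : 0 <= r -> {for r, continuous (fun r => tilt P r t)}.
Proof.
move=> r0.
have id1 : {for r, continuous (fun r : R => r)} by exact: cvg_id.
have cst (c : R) : {for r, continuous (fun=> c)} by exact: cvg_cst.
have wc y : {for r, continuous (fun r => output_weight P r y)}.
  exact: continuous_output_weight.
apply: continuousM; last first.
  apply: continuousV; first by rewrite gt_eqF // partition_sum_gt0.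
  apply: continuous_at_sum => y; apply: continuous_at_spow => //.
    exact: output_weight_dichotomy.
  exact: continuousD.
apply: continuousM; first by apply: continuousM; exact: continuous_letter_weight.
apply: continuous_at_spow => //; first exact: output_weight_dichotomy.
exact: continuousB.
Qed.

Lemma continuous_tilt_info (r : R) : 0 <= r -> {for r, continuous (tilt_info P)}.
Proof.
move=> r0; apply: continuous_at_sum => t.
have cst (c : R) : {for r, continuous (fun=> c)} by exact: cvg_cst.
have [w0|w0] := output_weight_dichotomy t.1.
  rewrite (_ : (fun _ => _) = fun _ : R => 0) //.
  by apply/funext => u; rewrite /tilt w0 spow0 mulr0 !mul0r.
apply: continuousM; first exact: continuous_tilt.
apply: continuousB.
  apply: continuousM => //; apply: continuousV; first by rewrite gt_eqF // ltr_pwDl.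
  by apply: continuousD => //; exact: cvg_id.
apply: (@continuous_comp _ _ _ (fun r => output_weight P r t.1) (@ln R)).
  exact: continuous_output_weight.
exact: continuous_ln.
Qed.

(* [tilt_info] is the derivative of [E0] in [rho], but the intermediate value
   theorem gives the optimality condition without differentiating. *)
Lemma critical_rho (Rt : R) : exists2 rho : R, 0 <= rho <= 1 &
  rho * tilt_info P rho - Num.max 0 (tilt_info P rho - Rt) = rho * Rt.
Proof.
have [J1|J1] := leP Rt (tilt_info P 1).
  by exists 1; rewrite ?ler01 ?lexx // max_r ?subr_ge0 // !mul1r subKr.
have [J0|J0] := leP (tilt_info P 0) Rt.
  by exists 0; rewrite ?ler01 ?lexx // max_l ?subr_le0 // !mul0r subr0.
have [|||rho rho01 Jrho] := @IVT R (tilt_info P) 0 1 Rt.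
- exact: ler01.
- apply: continuous_in_subspaceT => r; rewrite inE /= in_itv /= => /andP[r0 _].
  exact: continuous_tilt_info.
- by rewrite ge_min le_max (ltW J0) (ltW J1) orbT.
exists rho; first by move: rho01; rewrite in_itv.
by rewrite Jrho subrr maxxx subr0.
Qed.

End CriticalTilt.

(** * Lower bound on the average error by change of measure *)

Section EnsembleLowerBound.
Set Implicit Arguments.
Unset Strict Implicit.
Variables (R : realType) (q : nat) (Y : finType) (P : 'F_q -> Y -> R).
Hypotheses (q_prime : prime q) (P_channel : is_channel P).

Lemma mean_rowE (N : nat) (f : 'rV['F_q]_N -> R) :
  mean f = \sum_x q%:R^-1 ^+ N * f x.
Proof. by rewrite /mean card_mx card_Fp // mul1n natrX exprVn mulr_sumr. Qed.

Lemma min1M_le (b w : R) : 0 <= b -> 0 <= w <= 1 ->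
  Num.min 1 b * w <= Num.min 1 (b * w).
Proof.
move=> b0 /andP[w0 w1]; rewrite le_min; apply/andP; split.
  by apply: mulr_ile1; rewrite ?le_min ?ler01 ?b0 ?ge_min ?lexx.
by rewrite ler_wpM2r // ge_min lexx orbT.
Qed.

(** [channel_typical] changes the law of [(x, y)], while [confusion_ge_min] with [uniform_typical]
    changes that of the competitor [x']. What remains is a tilted probability. *)
Lemma avg_error_ge_tilt (K N : nat) (m : 'I_(q ^ K.+1)) (rho d J : R) :
  0 <= rho <= 1 -> J = tilt_info P rho ->
  (2 * q%:R)^-1 * (partition_sum P rho ^+ N * expR (N%:R * (rho * J - 2 * d)) *
    Num.min 1 (q%:R ^+ K.+1 * expR (N%:R * (- J - 2 * d)))) *
  (\sum_(y : 'rV[Y]_N) \sum_x \sum_x' tiltN P rho y x x' *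
     [&& typical P rho d x y, typical P rho d x' y & PN P x y <= PN P x' y]%:R)
  <= avg_error P N m.
Proof.
move=> rho01 -> {J}; set J := tilt_info P rho; rewrite avg_error_confusion // mean_rowE.
set B := expR (N%:R * (- J - 2 * d)); set A := _ ^+ N * expR _.
have A0 : 0 <= A by rewrite mulr_ge0 ?expR_ge0 // exprn_ge0 // ltW // partition_sum_gt0.
have q0 : 0 <= q%:R :> R by rewrite ler0n.
under [leRHS]eq_bigr do rewrite mulr_sumr.
rewrite [leRHS]exchange_big mulr_sumr /=; apply: ler_sum => y _.
rewrite mulr_sumr; apply: ler_sum => x _; rewrite [leRHS]mulrA.
have PN0 : 0 <= q%:R^-1 ^+ N * PN P x y.
  by rewrite mulr_ge0 ?(PN_ge0 P_channel) // exprn_ge0 // invr_ge0.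
have [typ|_] := boolP (typical P rho d x y); last first.
  rewrite big1 => [|x' _]; last by rewrite mulr0.
  by rewrite mulr0 (mulr_ge0 PN0) // confusion_ge0.
pose w := \sum_(x' : 'rV_N) (\prod_i cond_weight P rho (x' 0 i) (y 0 i)) *
  (typical P rho d x' y && (PN P x y <= PN P x' y))%:R.
have condN0 (x' : 'rV_N) : 0 <= \prod_i cond_weight P rho (x' 0 i) (y 0 i).
  by apply: prodr_ge0 => i _; exact: cond_weight_ge0.
have w0 : 0 <= w by apply: sumr_ge0 => x' _; rewrite mulr_ge0 ?ler0n.
(* Each coordinate carries conditional mass 1, or 0 when its output has weight 0. *)
have w1 : w <= 1.
  apply: (@le_trans _ _ (\sum_(x' : 'rV_N) \prod_i cond_weight P rho (x' 0 i) (y 0 i))).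
    by apply: ler_sum => x' _; case: (_ && _); rewrite ?mulr1 ?mulr0.
  rewrite (sum_row_prod (fun i a => cond_weight P rho a (y 0 i))).
  apply: prodr_ile1 => i _; rewrite sumr_ge0 => [|a _]; last exact: cond_weight_ge0.
  rewrite -mulr_suml -/(output_weight P rho (y 0 i)).
  have [->|W0] := eqVneq (output_weight P rho (y 0 i)) 0; first by rewrite mul0r ler01.
  by rewrite divff ?lexx.
have -> : \sum_x' tiltN P rho y x x' *
     [&& true, typical P rho d x' y & PN P x y <= PN P x' y]%:R =
     (\prod_i joint_weight P rho (x 0 i) (y 0 i)) * w.
  rewrite /w mulr_sumr; apply: eq_bigr => x' _; rewrite mulrA -big_split /=.
  by congr (_ * _); apply: eq_bigr => i _; exact: tilt_split.
have conf : (2 * q%:R)^-1 * (Num.min 1 (q%:R ^+ K.+1 * B) * w) <=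
    confusion R K.+1 (fun z => PN P x y <= PN P (x + z) y).
  have := @confusion_ge_min R 'F_q K N (fun z => PN P x y <= PN P (x + z) y).
  rewrite card_Fp //; apply: le_trans; rewrite ler_wpM2l ?invr_ge0 ?mulr_ge0 //.
  apply: le_trans (min1M_le _ _) _; rewrite ?w0 // ?mulr_ge0 ?expR_ge0 ?exprn_ge0 //.
  rewrite le_min ge_min lexx /= ge_min; apply/orP; right.
  rewrite -mulrA ler_wpM2l ?exprn_ge0 //.
  rewrite (mean_shift (fun x' => (PN P x y <= PN P x' y)%R%:R)) mean_rowE.
  rewrite /w mulr_sumr; apply: ler_sum => x' _.
  have [typ'|_] /= := boolP (typical P rho d x' y); last first.
    by rewrite !mulr0 mulr_ge0 ?ler0n // exprn_ge0 // invr_ge0.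
  by rewrite mulrA ler_wpM2r ?ler0n // mulrC uniform_typical.
have joint0 : 0 <= (\prod_i joint_weight P rho (x 0 i) (y 0 i)) * A.
  by rewrite mulr_ge0 //; apply: prodr_ge0 => i _; exact: joint_weight_ge0.
have min0 : 0 <= (2 * q%:R)^-1 * (Num.min 1 (q%:R ^+ K.+1 * B) * w).
  by rewrite !mulr_ge0 ?invr_ge0 ?mulr_ge0 // le_min ler01 mulr_ge0 ?expR_ge0 ?exprn_ge0.
apply: le_trans (ler_pM joint0 min0 (channel_typical q_prime P_channel rho01 typ) conf).
by rewrite le_eqVlt; apply/orP; left; apply/eqP; ring.
Qed.

Lemma tilt_var_ge0 rho : 0 <= tilt_var P rho.
Proof.
by rewrite !addr_ge0 //; apply: sumr_ge0 => t _; rewrite mulr_ge0 ?tilt_ge0 ?sqr_ge0.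
Qed.

(** The critical equation collapses the exponent to [E0 - rho * Rt]. The slack [5 * d] is [2 * d]
    for each of the two densities and [d] for the constant factors. *)
Lemma avg_error_lower (rho d Rt : R) : 0 <= rho <= 1 -> 0 < d ->
  rho * tilt_info P rho - Num.max 0 (tilt_info P rho - Rt) = rho * Rt ->
  exists N0 : nat, forall (N K : nat) (m : 'I_(q ^ K.+1)), (N0 <= N)%N ->
    K.+1%:R * ln (q%:R : R) = N%:R * Rt ->
    expR (- (N%:R * (E0 P rho (uniform_dist R (q:=q)) - rho * Rt + 5 * d))) <=
    avg_error P N m.
Proof.
move=> rho01 d0 crit; have /andP[rho0 _] := rho01.
have q0 : 0 < q%:R :> R by exact: natq_gt0.
pose C := tilt_var P rho / d ^+ 2.
have C0 : 0 <= C by rewrite mulr_ge0 ?tilt_var_ge0 ?invr_ge0 ?sqr_ge0.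
pose D := ln (8 * q%:R : R) / d.
(* The first term makes the Chebyshev defect [C / N] at most 1/2; the second makes [exp(N d)] at
   least [8 q], the product of the losses [2 q] and 4. *)
exists (Num.truncn (2 * C) + Num.truncn `|D|).+1 => N K m N0 rate.
have N_gt0 : (0 < N)%N by apply: leq_trans N0.
have NR0 : 0 < N%:R :> R by rewrite ltr0n.
have lt_trunc (r : R) (k : nat) : (Num.truncn r <= k)%N -> r < k.+1%:R.
  by move=> rk; apply: lt_le_trans (truncnS_gt r) _; rewrite ler_nat.
have NC : 2 * C <= N%:R.
  apply: ltW; apply: lt_le_trans (lt_trunc _ _ (leq_addr _ _)) _.
  by rewrite ler_nat; exact: N0.
have ND : D <= N%:R.
  apply: le_trans (ler_norm _) _; apply: ltW.
  apply: lt_le_trans (lt_trunc _ _ (leq_addl _ _)) _.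
  by rewrite ler_nat; exact: N0.
(* One half for the typical mass, one half for the comparison of [x] with [x']. *)
have quarter : 4^-1 <= \sum_(y : 'rV[Y]_N) \sum_x \sum_x' tiltN P rho y x x' *
     [&& typical P rho d x y, typical P rho d x' y & PN P x y <= PN P x' y]%:R.
  apply: le_trans (tilt_pairwise _ _ _ _ _) => //.
  rewrite (_ : 4^-1 = 2^-1 * 2^-1); last by field.
  rewrite ler_wpM2l ?invr_ge0 //.
  apply: le_trans (tilt_typical _ _ _ d0 N_gt0) => //.
  rewrite -/C; have : C / N%:R <= 2^-1 by rewrite ler_pdivrMr //; lra.
  by lra.
apply: le_trans (avg_error_ge_tilt N m d rho01 (erefl _)).
set J := tilt_info P rho in crit *.
have Z0 := partition_sum_gt0 q_prime P_channel rho.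
set X := (X in _ <= X * _).
have X0 : 0 <= X.
  apply: mulr_ge0; first by rewrite invr_ge0 mulr_ge0 ?(ltW q0).
  apply: mulr_ge0; first by rewrite mulr_ge0 ?expR_ge0 ?exprn_ge0 ?(ltW Z0).
  by rewrite le_min ler01 mulr_ge0 ?expR_ge0 ?exprn_ge0 ?(ltW q0).
apply: le_trans (ler_wpM2l X0 quarter); rewrite {X0}/X.
rewrite E0_partition_sum //.
have -> : (q%:R : R) ^+ K.+1 = expR (N%:R * Rt).
  by rewrite -rate expRM_natl lnK.
rewrite -expRD.
have minE : expR (- (N%:R * (Num.max 0 (J - Rt) + 2 * d))) <=
    Num.min 1 (expR (N%:R * Rt + N%:R * (- J - 2 * d))).
  rewrite le_min.
  have M0 : 0 <= Num.max 0 (J - Rt) by rewrite le_max lexx.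
  have M1 : J - Rt <= Num.max 0 (J - Rt) by rewrite le_max lexx orbT.
  apply/andP; split.
    by rewrite -[leRHS]expR0 ler_expR oppr_le0 mulr_ge0 ?(ltW NR0) //; lra.
  by rewrite ler_expR -mulrDr -mulrN ler_wpM2l ?(ltW NR0) //; lra.
have cE : expR (- (N%:R * d)) <= (2 * q%:R)^-1 * 4^-1.
  rewrite -invfM (_ : 2 * q%:R * 4 = 8 * q%:R :> R); last by ring.
  rewrite expRN lef_pV2 ?posrE ?expR_gt0 ?mulr_gt0 //.
  rewrite -[leLHS]lnK ?posrE ?mulr_gt0 // ler_expR -ler_pdivrMr //.
rewrite mulrAC.
have ZE : partition_sum P rho ^+ N = expR (N%:R * ln (partition_sum P rho)).
  by rewrite expRM_natl lnK.
set V := _ ^+ N * expR _.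
have V0 : 0 <= V by rewrite mulr_ge0 ?expR_ge0 ?exprn_ge0 ?(ltW Z0).
have VE := ler_wpM2l V0 minE.
have VE0 := mulr_ge0 V0 (expR_ge0 (- (N%:R * (Num.max 0 (J - Rt) + 2 * d)))).
apply: le_trans (ler_pM (expR_ge0 _) VE0 cE VE); rewrite {V0 VE VE0}/V.
rewrite ZE -!expRD ler_expR.
rewrite (_ : - (N%:R * (- ln (partition_sum P rho) - rho * Rt + 5 * d)) =
  N%:R * (ln (partition_sum P rho) + rho * Rt - 5 * d)); last by ring.
rewrite -crit; rewrite le_eqVlt; apply/orP; left; apply/eqP; ring.
Qed.

End EnsembleLowerBound.

(** * Both bounds combined into the limit *)

Theorem theorem2 (R : realType) (q : nat) (Y : finType) (P : 'F_q -> Y -> R) (Rt : R) :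
  prime q -> is_channel P -> in_U P -> 0 < Rt -> Rt < capacity P ->
  (exists K0 N0 : nat, (0 < N0)%N /\ K0%:R * ln (q%:R : R) = N0%:R * Rt) ->
  (forall N K : nat, (K < N)%N -> K%:R * ln (q%:R : R) = N%:R * Rt ->
     forall m m' : 'I_(q ^ K), avg_error P N m = avg_error P N m') /\
  (forall eps : R, 0 < eps -> exists N0 : nat, forall N K : nat, (N0 <= N)%N ->
     (K < N)%N -> K%:R * ln (q%:R : R) = N%:R * Rt ->
     forall m : 'I_(q ^ K),
       `| - (ln (avg_error P N m) / N%:R) - Er P Rt | < eps).
Proof.
move=> q_prime P_channel P_U Rt0 RtC _; split=> [N K _ _ m m'|eps eps0].
  by rewrite !avg_error_confusion.
have [rho rho01 crit] := critical_rho q_prime P_channel Rt.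
pose d := eps / 6; have d0 : 0 < d by rewrite divr_gt0.
have [N0 lower] := avg_error_lower q_prime P_channel rho01 d0 crit.
exists N0 => N [|K] N0N KN rate m.
  (* [K = 0] contradicts a positive rate, so a message has a leading coordinate for [affine_row]. *)
  by move/eqP: rate; rewrite mul0r eq_sym mulf_eq0 pnatr_eq0 gtn_eqF // gt_eqF.
move: {KN}(leq_trans (ltn0Sn _) KN) => N_gt0.
have NR0 : 0 < (N%:R : R) by rewrite ltr0n.
have {}lower := lower N K m N0N rate.
have avg0 : 0 < avg_error P N m by apply: lt_le_trans lower; exact: expR_gt0.
rewrite P_U ?(ltW Rt0) ?(ltW RtC) //; set E := (X in sup X).
set L := - (ln _ / _).
have E_rho : E (E0 P rho (uniform_dist R (q:=q)) - rho * Rt) by exists rho.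
(* Gallager's bound holds at every [r], so [L] dominates all of [E]; the lower bound on the error
   enters at the single critical [rho], and [5 * d < eps] closes the gap. *)
have L_ub : ubound E L.
  move=> _ [r [r01 ->]].
  have := avg_error_upper q_prime P_channel m r01 rate.
  rewrite -[leLHS]lnK // ler_expR lerNr -ler_pdivlMl // => /le_trans; apply.
  by rewrite /L mulrN mulrC.
have sup_le : sup E <= L by apply: ge_sup => //; exists (E0 P rho (uniform_dist R (q:=q)) - rho * Rt).
have le_sup : E0 P rho (uniform_dist R (q:=q)) - rho * Rt <= sup E.
  by apply: ub_le_sup E_rho; exists L.
have L_le : L <= E0 P rho (uniform_dist R (q:=q)) - rho * Rt + 5 * d.
  move: lower; rewrite -[leRHS]lnK // ler_expR lerNl -ler_pdivrMl // => /(le_trans _); apply.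
  by rewrite /L mulrN mulrC.
by rewrite ger0_norm ?subr_ge0 //; move: L_le le_sup; rewrite /d; lra.
Qed.
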